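(* For every even positive integer $p$ and every integer $m\ge 1$, $$\sum_{n=1}^{\infty}\frac{\left[\sum_{k=1}^{p/2}L_{(2k-1)mp^n}\right]-1}{F_{mp^{n+1}}} = \frac{1}{F_{mp}}.$$
   Context: $F_n$ and $L_n$ denote the $n$-th Fibonacci and Lucas numbers: $F_n = \frac{\alpha^n-\beta^n}{\sqrt5}$ and $L_n=\alpha^n+\beta^n$, where $\alpha=\frac{1+\sqrt5}{2}$ and $\beta=\frac{1-\sqrt5}{2}$ (so $F_0=0$, $F_1=1$, $L_0=2$, $L_1=1$). *)

(* Defs.v *)
From HB Require Import structures.
From mathcomp Require Import all_boot all_order all_algebra.
From mathcomp Require Import all_classical all_reals all_analysis.

Set Implicit Arguments.
Unset Strict Implicit.
Unset Printing Implicit Defensive.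

Import Order.TTheory GRing.Theory Num.Theory.
Local Open Scope ring_scope.

Definition alpha (R : realType) : R := (1 + Num.sqrt 5) / 2.
Definition beta (R : realType) : R := (1 - Num.sqrt 5) / 2.

Definition fib (R : realType) (n : nat) : R :=
  (alpha R ^+ n - beta R ^+ n) / Num.sqrt 5.

Definition lucas (R : realType) (n : nat) : R := alpha R ^+ n + beta R ^+ n.

(* Main.v *)
(** When [q] is even, [alpha ^ q * beta ^ q = 1], so the inner sum of the
    [L_((2k-1)q)] collapses to [F_(pq) / F_q].  With [q = m p^n] the [n]-th term
    of the series is therefore [1 / F_(m p^n) - 1 / F_(m p^(n+1))]; the series
    telescopes and the remainder vanishes because [F] grows at least linearly. *)
Require Import Defs.
From HB Require Import structures.
From mathcomp Require Import all_boot all_order all_algebra.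
From mathcomp Require Import all_classical all_reals all_analysis.
From mathcomp Require Import ring lra zify.

Set Implicit Arguments.
Unset Strict Implicit.
Unset Printing Implicit Defensive.

Import Order.TTheory GRing.Theory Num.Theory.
Import numFieldNormedType.Exports.
Local Open Scope classical_set_scope.
Local Open Scope ring_scope.

(** Since [a * b = 1], the cross terms of [(a - b) * (a ^+ j + b ^+ j)] drop by two degrees, leaving
    [a ^+ j.+1 - b ^+ j.+1] minus the same difference at [j - 1]; over odd [j] this telescopes. *)
Lemma sum_odd_powers_inverse (R : comNzRingType) (a b : R) (h : nat) :
  a * b = 1 ->
  (a - b) * (\sum_(1 <= k < h.+1) (a ^+ (2 * k - 1) + b ^+ (2 * k - 1)))
  = a ^+ (2 * h) - b ^+ (2 * h).
Proof.
move=> ab1; elim: h => [|h IHh]; first by rewrite big_geq // mulr0 !expr0 subrr.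
rewrite big_nat_recr //= mulrDr IHh.
have -> : (2 * h.+1 - 1 = (2 * h).+1)%N by lia.
have -> : (2 * h.+1 = (2 * h).+2)%N by lia.
rewrite !exprS.
set x := a ^+ _; set y := b ^+ _.
have -> : (a - b) * (a * x + b * y) =
  a * (a * x) - b * (b * y) + a * b * y - a * b * x by ring.
by rewrite ab1; ring.
Qed.

Lemma sqrt5_bounds (R : realType) : 2 <= Num.sqrt (5 : R) <= 3.
Proof.
have s0 : 0 <= Num.sqrt (5 : R) by apply: sqrtr_ge0.
have s2 : Num.sqrt (5 : R) ^+ 2 = 5 by rewrite sqr_sqrtr.
by apply/andP; split; nra.
Qed.

Lemma alphaMbeta (R : realType) : alpha R * beta R = -1.
Proof.
have s2 : Num.sqrt (5 : R) ^+ 2 = 5 by rewrite sqr_sqrtr.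
have -> : alpha R * beta R = (1 - Num.sqrt 5 ^+ 2) / 4.
  by rewrite /alpha /beta; field.
by rewrite s2; lra.
Qed.

Lemma expr_alphaMbeta_even (R : realType) (q : nat) :
  ~~ odd q -> alpha R ^+ q * beta R ^+ q = 1.
Proof. by move=> q_even; rewrite -exprMn alphaMbeta -signr_odd (negbTE q_even). Qed.

(** Bernoulli's inequality for [3 / 2 <= alpha R]; linear growth is enough for the limit. *)
Lemma alpha_expr_ge (R : realType) (n : nat) : 1 + n%:R / 2 <= alpha R ^+ n.
Proof.
have /andP[s2 s3] := sqrt5_bounds R.
elim: n => [|n IHn]; first by rewrite expr0 mul0r addr0.
have n0 : 0 <= n%:R :> R by [].
rewrite exprS -natr1.
have : 3 / 2 <= alpha R by rewrite /alpha; lra.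
by move: IHn; set x := alpha R ^+ n; nra.
Qed.

Lemma beta_expr_le1 (R : realType) (n : nat) : beta R ^+ n <= 1.
Proof.
have /andP[s2 s3] := sqrt5_bounds R.
apply: le_trans (ler_norm _) _; rewrite normrX exprn_ile1 //.
by rewrite ler_norml /beta; apply/andP; split; lra.
Qed.

(** The numerator is at least [n / 2] and the denominator [Num.sqrt 5] at most 3, whence the 6. *)
Lemma fib_ge (R : realType) (n : nat) : n%:R / 6 <= fib R n.
Proof.
have /andP[s2 s3] := sqrt5_bounds R.
rewrite /fib ler_pdivlMr; last by lra.
have := alpha_expr_ge R n; have := beta_expr_le1 R n.
have : 0 <= n%:R :> R by [].
by nra.
Qed.

Lemma fib_gt0 (R : realType) (n : nat) : (0 < n)%N -> 0 < fib R n.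
Proof. by move=> n0; apply: lt_le_trans (fib_ge R n); rewrite divr_gt0 ?ltr0n. Qed.

Lemma fibM_even (R : realType) (p q : nat) : ~~ odd p -> ~~ odd q ->
  fib R q * (\sum_(1 <= k < (p %/ 2).+1) lucas R ((2 * k - 1) * q)%N)
  = fib R (q * p)%N.
Proof.
move=> p_even q_even.
have p2 : (p = 2 * (p %/ 2))%N by lia.
rewrite /fib mulrAC {2 3}p2 !exprM.
(* The exponent [2 * (p %/ 2)] is joined again, to use the telescoping identity at [alpha R ^+ q]
   and [beta R ^+ q]. *)
rewrite -[in RHS](exprM _ 2) -[in RHS](exprM _ 2).
rewrite -sum_odd_powers_inverse ?expr_alphaMbeta_even //.
congr (_ * _ / _); apply: eq_bigr => k _.
by rewrite /lucas mulnC !exprM.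
Qed.

Theorem theorem6 (R : realType) (p m : nat) (p_gt0 : (0 < p)%N)
    (p_even : ~~ odd p) (m_ge1 : (1 <= m)%N) :
  (fun N : nat =>
     \sum_(1 <= n < N.+1)
        (\sum_(1 <= k < (p %/ 2).+1) lucas R ((2 * k - 1) * m * p ^ n)%N - 1)
          / fib R (m * p ^ n.+1)%N) @ \oo
    --> (fib R (m * p)%N)^-1.
Proof.
pose F n := fib R (m * p ^ n)%N.
have F_gt0 n : 0 < F n by apply: fib_gt0; rewrite muln_gt0 m_ge1 expn_gt0 p_gt0.
have partial_sum (N : nat) : \sum_(1 <= n < N.+1)
    (\sum_(1 <= k < (p %/ 2).+1) lucas R ((2 * k - 1) * m * p ^ n)%N - 1)
      / fib R (m * p ^ n.+1)%N = (F 1)^-1 - (F N.+1)^-1.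
  rewrite -opprB -(telescope_sumr (fun n => (F n)^-1)) // -sumrN.
  apply: eq_big_nat => n /andP[n_gt0 _]; rewrite opprB.
  (* This needs [n >= 1]: at [n = 0] the index is [m], which may be odd. *)
  have q_even : ~~ odd (m * p ^ n).
    by rewrite oddM oddX (negbTE p_even) orbF eqn0Ngt n_gt0 andbF.
  have := fibM_even R p_even q_even.
  rewrite -mulnA -expnSr -/(F n) -/(F n.+1).
  under eq_bigr do rewrite mulnA.
  move=> FS; rewrite mulrBl mul1r; congr (_ - _).
  apply: (mulfI (lt0r_neq0 (F_gt0 n))).
  by rewrite mulrA FS !mulfV ?lt0r_neq0.
have invF_cvg0 : (fun N => (F N.+1)^-1) @ \oo --> (0 : R).
  (* [harmonic N] is [1 / (N + 1)], and [fib_ge] with [m * p ^ N.+1 >= N.+1] bounds [(F N.+1)^-1] by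
     six times it. *)
  have harmonic6 : (fun N => 6 * @harmonic R N) @ \oo --> (0 : R).
    rewrite -(mulr0 6); apply: cvgMr; exact: cvg_harmonic.
  apply: (squeeze_cvgr _ (cvg_cst (0 : R)) harmonic6).
  apply: nearW => N; rewrite invr_ge0 (ltW (F_gt0 _)) /=.
  rewrite -[6]invrK -invfM lef_pV2 ?posrE ?F_gt0 ?mulr_gt0 //.
  apply: le_trans (fib_ge R _); rewrite mulrC ler_pM2r ?invr_gt0 // ler_nat.
  (* Being even and positive, [p] is at least 2, so its powers exceed their exponents. *)
  have p_gt1 : (1 < p)%N by lia.
  by apply: leq_trans (leq_pmull _ m_ge1); apply: ltnW (ltn_expl _ p_gt1).
have -> : (fib R (m * p)%N)^-1 = (F 1)^-1 - 0 by rewrite subr0 /F expn1.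
under eq_fun do rewrite partial_sum.
exact: (cvgB (cvg_cst _) invF_cvg0).
Qed.
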